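(* Let $z:=(x,y)$ be a local optimal solution of the problem $$\min_z\ F(z)\quad\text{s.t.}\quad G(z)\le0,\ g(z)\le0,\ f(z)-\varphi(z)\le0.\qquad(\mathrm{P})$$ Suppose that $S_0$ is inner semicontinuous at the point $(x,y,y)$ with $y\in S_0(z)$, where the lower-level regularity condition also holds. Furthermore, suppose that problem (P) is partially calm at $z$, where the upper-level regularity condition is also satisfied. Then there exist $\lambda\in(0,\infty)$, $u\in\mathbb{R}^p$ and $(v,w)\in\mathbb{R}^{2q}$ such that $$\nabla F(z)+\nabla G(z)^\top u+\nabla g(z)^\top v+\lambda\nabla f(z)-\lambda\nabla_z\ell(z,y,w)=0,$$ $$f_0(z)+\nabla_3g_0(x,y,y)^\top w=0,$$ $$u\ge0,\ G(z)\le0,\ u^\top G(z)=0,$$ $$v\ge0,\ g(z)\le0,\ v^\top g(z)=0,$$ $$w\ge0,\ g_0(z,y)\le0,\ w^\top g_0(z,y)=0,$$ where $\nabla_z\ell(z,y,w)$ is the gradient of $(x,y)\mapsto\ell(x,y,\varsigma,w)$ (with $\varsigma,w$ fixed) evaluated at $\varsigma=y$, and $\nabla_3g_0(x,y,y)$ is the Jacobian of $\varsigma\mapsto g_0(x,y,\varsigma)$ evaluated at $\varsigma=y$.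
   Context: Data: $F:\mathbb{R}^n\times\mathbb{R}^m\to\mathbb{R}$, $G:\mathbb{R}^n\times\mathbb{R}^m\to\mathbb{R}^p$, $f_0:\mathbb{R}^n\times\mathbb{R}^m\to\mathbb{R}^m$, $g_0:\mathbb{R}^n\times\mathbb{R}^m\times\mathbb{R}^m\to\mathbb{R}^q$ are twice continuously differentiable; no convexity is assumed; inequalities between vectors are componentwise. Write $z:=(x,y)$, $g(z):=g_0(x,y,y)$, $f(z):=y^\top f_0(x,y)$, $g_0(z,\varsigma):=g_0(x,y,\varsigma)$, $K(x,y):=\{\varsigma\in\mathbb{R}^m\mid g_0(x,y,\varsigma)\le0\}$, $\varphi(z):=\min_\varsigma\{\varsigma^\top f_0(x,y)\mid\varsigma\in K(x,y)\}$, $S_0(z):=\arg\min_\varsigma\{\varsigma^\top f_0(x,y)\mid\varsigma\in K(x,y)\}$, and $\ell(x,y,\varsigma,w):=\varsigma^\top f_0(x,y)+w^\top g_0(x,y,\varsigma)$. (Problem (P) is the value-function reformulation of minimizing $F(x,y)$ subject to $G(x,y)\le0$ and $y\in S(x)$, where $S$ is the solution map of the quasi-variational inequality: find $y\in K(x,y)$ with $\langle f_0(x,y),\varsigma-y\rangle\ge0$ for all $\varsigma\in K(x,y)$.) Inner semicontinuity: $S_0$ is inner semicontinuous at $(x,y,y)\in\mathrm{gph}\,S_0$ if for every sequence $z_k\to z=(x,y)$ there are $\varsigma_k\in S_0(z_k)$ with $\varsigma_k\to y$. Lower-level regularity at $(x,y,\varsigma)$: there is $d\in\mathbb{R}^m$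 with $\nabla_3g_{0j}(x,y,\varsigma)^\top d<0$ for all $j$ with $g_{0j}(x,y,\varsigma)=0$. Upper-level regularity at $z$: there is $d\in\mathbb{R}^{n+m}$ with $\nabla G_i(z)^\top d<0$ for all $i$ with $G_i(z)=0$ and $\nabla g_j(z)^\top d<0$ for all $j$ with $g_j(z)=0$. Partial calmness: (P) is partially calm at a feasible point $\bar z$ if there are $\lambda\in(0,\infty)$ and a neighborhood $U$ of $(0,\bar z)$ in $\mathbb{R}\times\mathbb{R}^{n+m}$ such that $F(z)-F(\bar z)+\lambda|\varsigma|\ge0$ for all $(\varsigma,z)\in U$ with $G(z)\le0$, $g(z)\le0$, $f(z)-\varphi(z)+\varsigma=0$ (here $\varsigma\in\mathbb{R}$). *)

(* Defs.v *)
From mathcomp Require Export all_boot all_order all_algebra.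
From mathcomp Require Export all_classical all_reals all_analysis.
Export Order.TTheory GRing.Theory Num.Theory numFieldNormedType.Exports.

Set Implicit Arguments.
Unset Strict Implicit.
Unset Printing Implicit Defensive.

Local Open Scope classical_set_scope.
Local Open Scope ring_scope.

(* R^n is 'rV[R]_n, and R^n x R^m is identified with 'rV[R]_(n + m), the pair
   (x, y) being row_mx x y.  The library Jacobian acts on row vectors from the
   right: 'J h z has the partial derivatives of h_j in its j-th COLUMN, so
   (nabla h(z))^T u is the row vector u *m ('J h z)^T. *)

Definition dot (R : realType) (k : nat) (u v : 'rV[R]_k) : R :=
  \sum_(i < k) u 0 i * v 0 i.

Definition nonneg (R : realType) (k : nat) (u : 'rV[R]_k) : Prop :=
  forall i, 0 <= u 0 i.

Definition nonpos (R : realType) (k : nat) (u : 'rV[R]_k) : Prop :=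
  forall i, u 0 i <= 0.

Definition grad (R : realType) (k : nat) (h : 'rV[R]_k -> R) (a : 'rV[R]_k) :
  'rV[R]_k := \row_(i < k) 'D_(delta_mx 0 i) h a.

(* On finite-dimensional V, continuity of all directional derivatives is
   continuity of the derivative; similarly at second order. *)
Definition C1 (R : realType) (V W : normedModType R) (h : V -> W) : Prop :=
  (forall a, differentiable h a) /\ (forall v, continuous ('D_v h)).

Definition C2 (R : realType) (V W : normedModType R) (h : V -> W) : Prop :=
  C1 h /\ (forall v, C1 ('D_v h)).

Definition K (R : realType) (N m q : nat)
    (g0 : 'rV[R]_N -> 'rV[R]_m -> 'rV[R]_q) (z : 'rV[R]_N) : set 'rV[R]_m :=
  [set s | nonpos (g0 z s)].

(* The value function is extended-real valued: it is the minimum whenever the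
   minimum exists, +oo if K(z) is empty and -oo if the objective is unbounded
   below on K(z). *)
Definition phi (R : realType) (N m q : nat) (f0 : 'rV[R]_N -> 'rV[R]_m)
    (g0 : 'rV[R]_N -> 'rV[R]_m -> 'rV[R]_q) (z : 'rV[R]_N) : \bar R :=
  ereal_inf [set (dot s (f0 z))%:E | s in K g0 z].

Definition S0 (R : realType) (N m q : nat) (f0 : 'rV[R]_N -> 'rV[R]_m)
    (g0 : 'rV[R]_N -> 'rV[R]_m -> 'rV[R]_q) (z : 'rV[R]_N) : set 'rV[R]_m :=
  [set s | K g0 z s /\
           forall t, K g0 z t -> dot s (f0 z) <= dot t (f0 z)].

Definition lagr (R : realType) (N m q : nat) (f0 : 'rV[R]_N -> 'rV[R]_m)
    (g0 : 'rV[R]_N -> 'rV[R]_m -> 'rV[R]_q)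
    (z : 'rV[R]_N) (s : 'rV[R]_m) (w : 'rV[R]_q) : R :=
  dot s (f0 z) + dot w (g0 z s).

Definition fdiag (R : realType) (n m : nat)
    (f0 : 'rV[R]_(n + m) -> 'rV[R]_m) (z : 'rV[R]_(n + m)) : R :=
  dot (rsubmx z) (f0 z).

Definition gdiag (R : realType) (n m q : nat)
    (g0 : 'rV[R]_(n + m) -> 'rV[R]_m -> 'rV[R]_q) (z : 'rV[R]_(n + m)) :
  'rV[R]_q := g0 z (rsubmx z).

Definition feasible (R : realType) (n m p q : nat)
    (G : 'rV[R]_(n + m) -> 'rV[R]_p) (f0 : 'rV[R]_(n + m) -> 'rV[R]_m)
    (g0 : 'rV[R]_(n + m) -> 'rV[R]_m -> 'rV[R]_q) : set 'rV[R]_(n + m) :=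
  [set z | [/\ nonpos (G z), nonpos (gdiag g0 z) &
             ((fdiag f0 z)%:E - phi f0 g0 z <= 0)%E]].

Definition local_solution (R : realType) (n m p q : nat)
    (F : 'rV[R]_(n + m) -> R) (G : 'rV[R]_(n + m) -> 'rV[R]_p)
    (f0 : 'rV[R]_(n + m) -> 'rV[R]_m)
    (g0 : 'rV[R]_(n + m) -> 'rV[R]_m -> 'rV[R]_q) (z : 'rV[R]_(n + m)) : Prop :=
  feasible G f0 g0 z /\
  \forall z' \near z, feasible G f0 g0 z' -> F z <= F z'.

Definition inner_semicontinuous (R : realType) (N m : nat)
    (S : 'rV[R]_N -> set 'rV[R]_m) (z : 'rV[R]_N) (y : 'rV[R]_m) : Prop :=
  S z y /\
  forall zk : nat -> 'rV[R]_N, zk @ \oo --> z ->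
    exists sk : nat -> 'rV[R]_m, (forall k, S (zk k) (sk k)) /\ sk @ \oo --> y.

Definition lower_regular (R : realType) (N m q : nat)
    (g0 : 'rV[R]_N -> 'rV[R]_m -> 'rV[R]_q) (z : 'rV[R]_N) (s : 'rV[R]_m) :
  Prop :=
  exists d : 'rV[R]_m, forall j,
    g0 z s 0 j = 0 -> dot (grad (fun t => g0 z t 0 j) s) d < 0.

Definition upper_regular (R : realType) (n m p q : nat)
    (G : 'rV[R]_(n + m) -> 'rV[R]_p)
    (g0 : 'rV[R]_(n + m) -> 'rV[R]_m -> 'rV[R]_q) (z : 'rV[R]_(n + m)) : Prop :=
  exists d : 'rV[R]_(n + m),
    (forall i, G z 0 i = 0 -> dot (grad (fun a => G a 0 i) z) d < 0) /\
    (forall j, gdiag g0 z 0 j = 0 ->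
       dot (grad (fun a => gdiag g0 a 0 j) z) d < 0).

Definition partially_calm (R : realType) (n m p q : nat)
    (F : 'rV[R]_(n + m) -> R) (G : 'rV[R]_(n + m) -> 'rV[R]_p)
    (f0 : 'rV[R]_(n + m) -> 'rV[R]_m)
    (g0 : 'rV[R]_(n + m) -> 'rV[R]_m -> 'rV[R]_q) (zb : 'rV[R]_(n + m)) : Prop :=
  exists2 lam : R, 0 < lam &
  exists2 U : set (R * 'rV[R]_(n + m)), nbhs (0 : R, zb) U &
  forall (s : R) (z : 'rV[R]_(n + m)), U (s, z) ->
    nonpos (G z) -> nonpos (gdiag g0 z) ->
    ((fdiag f0 z)%:E - phi f0 g0 z + s%:E = 0)%E ->
    0 <= F z - F zb + lam * `|s|.

(* Main.v *)
Require Import Defs.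
From mathcomp Require Import ring lra.

(** Partial calmness turns the constraint [f - phi <= 0] into an exact penalty: near
    [z], and under the constraints [G <= 0] and [g <= 0] only, the function
    [F + lam * (f - phi)] is minimal at [z]. The difficulty is the value function
    [phi], which is nonsmooth. Only an upper estimate of [f - phi], that is
    a lower estimate of [phi] at points close to [z], is needed, and it
    can be obtained from lower-level feasible points alone.

    Let [H (z, s)] be the lower-level objective, let [d] be a direction that strictly
    decreases the active components of [G] and [g], and put [z_k = z + t_k d]. Inner
    semicontinuity provides [s_k] in [S0 z_k] tending to [y]. Let [eta] be such that
    the derivative along [(- d, eta)] of every active component of the lower-level
    constraint [g0] is negative at [(z, y)]. Then [s_k + t_k eta] is feasible for the
    problem at [z], so that [phi z <= H (z, s_k + t_k eta)] while
    [phi z_k = H (z_k, s_k)]. Substituting this into the penalized inequality,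
    dividing by [t_k] and letting [k] grow yields ([calm_value_inequality])
    [0 <= F' d + lam * (f' d + H' (- d, eta))], where primes denote derivatives at
    [z] and [(z, y)]. The quotients converge although the base points [s_k] move,
    because the data are continuously differentiable ([strict_quotient_cvg]).

    Thus a linear functional of [(d, eta)] is nonnegative on the solutions of a
    finite system of strict linear inequalities. The two regularity conditions make this
    system solvable, so the theorem of the alternative ([gordan_alternative],
    [motzkin_multipliers]) writes the functional as minus a nonnegative combination
    of those in the system. The coefficients are [u], [v] and [lam * w]; the [d] part of
    the relation is upper-level stationarity and the [eta] part is lower-level
    stationarity. In this way the multiplier [w] of the lower-level problem and those
    of the upper-level problem come out of a single duality argument, and no
    subdifferential of [phi] enters. *)

Set Implicit Arguments.
Unset Strict Implicit.
Unset Printing Implicit Defensive.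
Local Open Scope classical_set_scope.
Local Open Scope ring_scope.

(** * Systems of strict linear inequalities *)

(** A direction correcting one inequality can be added, suitably scaled,
    without spoiling the finitely many strict inequalities already achieved. *)
Lemma small_perturbation_neg (R : realFieldType) (I : eqType) (s : seq I)
    (al be : I -> R) :
  (forall i, i \in s -> al i < 0) ->
  exists2 eps, 0 < eps & forall i, i \in s -> al i + eps * be i < 0.
Proof.
elim: s => [|i s IH] neg; first by exists 1.
have [|eps eps0 epsP] := IH.
  by move=> j js; apply: neg; rewrite in_cons js orbT.
have ai : al i < 0 by apply: neg; rewrite mem_head.
have den : 0 < 1 + `|be i| by rewrite ltr_pwDl.
pose d := Num.min eps (- al i / (1 + `|be i|)).
have d0 : 0 < d by rewrite lt_min eps0 divr_gt0 // oppr_gt0.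
exists d => // j; rewrite in_cons => /predU1P[-> | js].
  have : d * (1 + `|be i|) <= - al i by rewrite -ler_pdivlMr // ge_min lexx orbT.
  have : d * be i <= d * `|be i| by rewrite ler_pM2l // ler_norm.
  by rewrite mulrDr mulr1; lra.
have aj : al j < 0 by apply: neg; rewrite in_cons js orbT.
have [b0|b0] := lerP (be j) 0.
  by rewrite -[ltRHS]addr0 ltr_leD // pmulr_rle0.
by apply: le_lt_trans (epsP j js); rewrite lerD2l ler_pM2r // ge_min lexx.
Qed.

(** Theorem of the alternative of Gordan, by induction on the number of
    inequalities. A solution [x0] of the remaining inequalities either solves
    the new one [b i0 x < 0], or is used to eliminate [b i0] from the others,
    which puts the problem on the kernel of [b i0]. Working with functionals on an
    arbitrary module avoids any choice of coordinates. *)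
Lemma gordan_alternative (R : realFieldType) (V : lmodType R) (I : finType)
    (s : seq I) (b : I -> V -> R) :
  (forall i, scalar (b i)) ->
  (exists x, forall i, i \in s -> b i x < 0) \/
  (exists mu : I -> R,
    [/\ forall i, 0 <= mu i, forall i, i \notin s -> mu i = 0,
        exists i, 0 < mu i & forall x, \sum_i mu i * b i x = 0]).
Proof.
elim: s b => [|i0 s IH] b lin; first by left; exists 0.
have bD i a u v : b i (a *: u + v) = a * b i u + b i v by exact: lin.
have [[x0 x0P]|[mu [mu0 musupp mupos mub]]] := IH b lin; last first.
  right; exists mu; split => // i; rewrite in_cons negb_or => /andP[_].
  exact: musupp.
have [bx0|bx0] := ltrP (b i0 x0) 0.
  by left; exists x0 => i; rewrite in_cons => /predU1P[->|/x0P].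
have [[x1 bx1]|nox1] := pselect (exists x, b i0 x < 0); last first.
  have bi0 x : b i0 x = 0.
    have b0 : b i0 0 = 0 by have := bD i0 1 0 0; rewrite scaler0 addr0; lra.
    apply/eqP; rewrite eq_le; apply/andP; split; rewrite leNgt; apply/negP => bx.
      by apply: nox1; exists (- 1 *: x + 0); rewrite bD b0; lra.
    by apply: nox1; exists x.
  right; exists (fun i => (i == i0)%:R); split => //.
  - by move=> i; rewrite in_cons negb_or => /andP[/negPf ->].
  - by exists i0; rewrite eqxx.
  - move=> x; rewrite (bigD1 i0) //= bi0 mulr0 add0r big1 // => i /negPf ->.
    by rewrite mul0r.
(* A point where [b i0] vanishes and the other functionals are negative can be
   pushed along [x1], which makes [b i0] negative as well. *)
have push x : b i0 x = 0 -> (forall i, i \in s -> b i x < 0) ->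
    exists x, forall i, i \in i0 :: s -> b i x < 0.
  move=> bx bs.
  have [eps eps0 epsP] := small_perturbation_neg (b ^~ x1) bs.
  exists (eps *: x1 + x) => i; rewrite bD in_cons => /predU1P[->|/epsP].
    by rewrite bx addr0 pmulr_rlt0.
  by rewrite addrC.
move: bx0; rewrite le_eqVlt => /predU1P[bx0|bx0].
  by left; apply: (push x0).
(* Adding to each [b i] the multiple of [b i0] that makes it vanish at [x0] lets
   a solution of the modified system be corrected along [x0] at no cost; the
   factors [r i] are nonnegative, so multipliers survive the substitution. *)
pose r i := - b i x0 / b i0 x0.
pose b' i x := b i x + r i * b i0 x.
have lin' i : scalar (b' i).
  by move=> a u v; rewrite /b' !bD; ring.
have bi00 : b i0 x0 != 0 by rewrite gt_eqF.
have [[x xP]|[mu [mu0 musupp [k muk] mub]]] := IH b' lin'.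
  left; apply: (push (- (b i0 x / b i0 x0) *: x0 + x)).
    by rewrite bD mulNr divfK // addNr.
  move=> i /xP; rewrite bD /b' /r.
  by congr (_ < 0); field.
right; pose c := \sum_i mu i * r i.
have c0 : 0 <= c.
  apply: sumr_ge0 => i _; have [is_|nis] := boolP (i \in s).
    by rewrite mulr_ge0 // /r divr_ge0 ?oppr_ge0 ?(ltW bx0) // ltW // x0P.
  by rewrite musupp // mul0r.
exists (fun i => mu i + (i == i0)%:R * c); split.
- by move=> i; rewrite addr_ge0 // mulr_ge0.
- move=> i; rewrite in_cons negb_or => /andP[/negPf -> /musupp ->].
  by rewrite mul0r addr0.
- by exists k; rewrite ltr_pwDl // mulr_ge0.
- move=> x; rewrite -[RHS](mub x) /b'.
  under eq_bigr do rewrite mulrDl.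
  under [RHS]eq_bigr do rewrite mulrDr mulrA.
  rewrite !big_split /= -mulr_suml -/c; congr (_ + _).
  rewrite (bigD1 i0) //= eqxx mul1r big1 ?addr0 // => i /negPf ->.
  by rewrite !mul0r.
Qed.

(** Gordan's alternative for [c] together with the functionals selected by [A].
    The Slater point [x0] is what normalizes the multiplier of [c] to one. *)
Lemma motzkin_multipliers (R : realFieldType) (V : lmodType R) (I : finType)
    (A : pred I) (b : I -> V -> R) (c : V -> R) :
  (forall i, scalar (b i)) -> scalar c ->
  (exists x, forall i, A i -> b i x < 0) ->
  (forall x, (forall i, A i -> b i x < 0) -> 0 <= c x) ->
  exists mu : I -> R,
    [/\ forall i, 0 <= mu i, forall i, ~~ A i -> mu i = 0
      & forall x, c x + \sum_i mu i * b i x = 0].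
Proof.
move=> linb linc [x0 x0P] cP.
pose b' (o : option I) := if o is Some i then b i else c.
have lin' o : scalar (b' o) by case: o => [i|]; [exact: linb | exact: linc].
pose s := None :: [seq Some i | i <- enum A].
have Some_s i : (Some i \in s) = A i.
  by rewrite in_cons /= mem_map ?mem_enum // => ? ? [].
have [[x xP]|[mu [mu0 musupp [k muk] mub]]] := gordan_alternative s lin'.
  have := xP None (mem_head _ _); rewrite /= ltNge cP // => i Ai.
  by apply: (xP (Some i)); rewrite Some_s.
have supp i : ~~ A i -> mu (Some i) = 0 by move=> nA; rewrite musupp // Some_s.
have sumE x : mu None * c x + \sum_i mu (Some i) * b i x = 0.
  rewrite -[RHS](mub x) (bigD1 None) //= (reindex_omap Some id) => [|[]//].
  by apply: (congr1 (+%R _)); apply: eq_bigl => i; rewrite eqxx.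
(* Were the multiplier of [c] zero, evaluating the relation at [x0] would give a
   negative number. *)
have muN : 0 < mu None.
  rewrite lt_neqAle mu0 andbT eq_sym; apply/eqP => muN0.
  have le0 i : mu (Some i) * b i x0 <= 0.
    have [Ai|/supp ->] := boolP (A i); last by rewrite mul0r.
    by rewrite mulr_ge0_le0 // ltW // x0P.
  have := sumE x0; rewrite muN0 mul0r add0r => /eqP.
  case: k muk => [i mui|]; last by rewrite muN0 ltxx.
  have Ai : A i by apply: contraTT mui => /supp ->; rewrite ltxx.
  rewrite (bigD1 i) //= lt_eqF // -[ltRHS]addr0 ltr_leD //.
    by rewrite pmulr_rlt0 // x0P.
  exact: sumr_le0.
exists (fun i => mu (Some i) / mu None); split.
- by move=> i; rewrite divr_ge0.
- by move=> i /supp ->; rewrite mul0r.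
- move=> x; have muN0 : mu None != 0 by rewrite gt_eqF.
  apply: (mulfI muN0); rewrite mulr0 mulrDr -[RHS](sumE x); congr (_ + _).
  rewrite mulr_sumr; apply: eq_bigr => i _.
  by rewrite mulrA mulrCA divff // mulr1.
Qed.

(** * Calculus of continuously differentiable functions *)

Lemma scalar_derive (R : realType) (V : normedModType R) (h : V -> R) (a : V) :
  differentiable h a -> scalar (fun v => 'D_v h a).
Proof. by move=> dh c u v; rewrite !deriveE // linearP. Qed.

Lemma derive_scale (R : realType) (V : normedModType R) (h : V -> R) (a v : V)
    (t : R) :
  differentiable h a -> 'D_(t *: v) h a = t * 'D_v h a.
Proof. by move=> dh; rewrite !deriveE // linearZ. Qed.

(** Reflecting the first component preserves linearity: displacements of the
    upper-level variable enter the lower-level data with a minus sign, since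
    the lower-level solution is carried back from [z + t d] to [z]. *)
Lemma scalar_derive_reflect (R : realType) (U V : normedModType R)
    (h : U * V -> R) (a : U * V) :
  differentiable h a -> scalar (fun e : U * V => 'D_(- e.1, e.2) h a).
Proof.
move=> dh c u v; rewrite -(scalar_derive dh c).
suff -> : (- (c *: u + v).1, (c *: u + v).2) =
  c *: (- u.1, u.2) + (- v.1, v.2) by [].
by congr pair; rewrite /= opprD scalerN.
Qed.

Lemma derive_coord (R : realType) (V : normedModType R) (k : nat)
    (h : V -> 'rV[R]_k) (a v : V) (j : 'I_k) :
  differentiable h a -> 'D_v (fun b => h b 0 j) a = ('D_v h a) 0 j.
Proof. by move=> /(diff_derivable (v := v)) /derive_mx ->; rewrite mxE. Qed.

Lemma dot_grad (R : realType) (k : nat) (h : 'rV[R]_k -> R) (a d : 'rV[R]_k) :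
  differentiable h a -> dot (grad h a) d = 'D_d h a.
Proof.
move=> dh; rewrite [X in 'D_X _ _]row_sum_delta deriveE // linear_sum.
apply: eq_bigr => i _; rewrite linearZ /= mxE deriveE //.
by rewrite mulrC.
Qed.

Lemma mul_jacobian_tr (R : realType) (k l : nat) (h : 'rV[R]_k -> 'rV[R]_l)
    (a : 'rV[R]_k) (u : 'rV[R]_l) (i : 'I_k) :
  differentiable h a ->
  (u *m ('J h a)^T) 0 i = \sum_j u 0 j * 'D_(delta_mx 0 i) (fun b => h b 0 j) a.
Proof.
move=> dh; rewrite mxE; apply: eq_bigr => j _; congr (_ * _).
by rewrite derive_coord // deriveEjacobian // -rowE !mxE.
Qed.

(** [L0] is the linear part of the affine map [L]: the difference quotients of
    both sides coincide. *)
Lemma derive_comp_affine (R : realType) (U V W : normedModType R)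
    (L L0 : U -> V) (h : V -> W) :
  (forall a v (t : R), L (t *: v + a) = t *: L0 v + L a) ->
  forall a v, 'D_v (h \o L) a = 'D_(L0 v) h (L a).
Proof.
move=> LE a v; rewrite /derive.
set e1 := (X in lim (X @ _)); set e2 := (X in _ = lim (X @ _)).
by suff -> : e1 = e2 by []; apply/funext => t; rewrite /e1 /e2 /= LE.
Qed.

(** All the functions derived from the data (diagonal maps, partial maps, the
    lower-level objective) arise from them by affine substitutions, sums and
    products. *)
Lemma C1_comp_affine (R : realType) (U V W : normedModType R)
    (L L0 : U -> V) (h : V -> W) :
  (forall a v (t : R), L (t *: v + a) = t *: L0 v + L a) ->
  (forall a, differentiable L a) -> C1 h -> C1 (h \o L).
Proof.
move=> LE dL [dh ch]; split=> [a|v a]; first exact: differentiable_comp.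
have -> : 'D_v (h \o L) = 'D_(L0 v) h \o L.
  by apply/funext => b; exact: derive_comp_affine.
apply: continuous_comp; last exact: ch.
exact: differentiable_continuous.
Qed.

Lemma C1_id (R : realType) (V : normedModType R) : C1 (@id V).
Proof.
split=> [a|v a]; first exact: ex_diff.
have -> : 'D_v (@id V) = cst v by apply/funext => b; exact: derive_id.
exact: cvg_cst.
Qed.

Lemma C1_cst (R : realType) (V W : normedModType R) (w : W) :
  C1 (fun _ : V => w).
Proof.
split=> [a|v a]; first exact: differentiable_cst.
have -> : 'D_v (fun=> w) = cst (0 : W) by apply/funext => b; exact: derive_cst.
exact: cvg_cst.
Qed.

Lemma C1_coord (R : realType) (V : normedModType R) (k : nat)
    (h : V -> 'rV[R]_k) (j : 'I_k) : C1 h -> C1 (fun a => h a 0 j).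
Proof.
move=> [dh ch]; split=> [a|v a].
  apply: (@differentiable_comp _ _ _ _ h (fun M : 'rV[R]_k => M 0 j)) => //.
  exact: differentiable_coord.
have -> : 'D_v (fun b => h b 0 j) = (fun M : 'rV[R]_k => M 0 j) \o 'D_v h.
  by apply/funext => b; exact: derive_coord.
apply: continuous_comp; first exact: ch.
exact: coord_continuous.
Qed.

Lemma C1_mul (R : realType) (V : normedModType R) (h k : V -> R) :
  C1 h -> C1 k -> C1 (fun a => h a * k a).
Proof.
move=> [dh ch] [dk ck]; split=> [a|v a]; first exact: differentiableM.
have -> : 'D_v (fun b => h b * k b) =
    (fun b => h b * 'D_v k b + k b * 'D_v h b).
  by apply/funext => b; rewrite deriveM //; exact: diff_derivable.
have hc := differentiable_continuous (dh a).
have kc := differentiable_continuous (dk a).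
exact: (cvgD (cvgM hc (ck v a)) (cvgM kc (ch v a))).
Qed.

Lemma C1_sum (R : realType) (V : normedModType R) (k : nat)
    (h : 'I_k -> V -> R) :
  (forall i, C1 (h i)) -> C1 (fun a => \sum_i h i a).
Proof.
move=> C1h; have -> : (fun a => \sum_i h i a) = \sum_i h i.
  by apply/funext => a; rewrite fct_sumE.
split=> [a|v a]; first by apply: differentiable_sum => i; exact: (C1h i).1.
have -> : 'D_v (\sum_i h i) = (fun b => \sum_i 'D_v (h i) b).
  apply/funext => b; rewrite derive_sum // => i.
  exact: diff_derivable ((C1h i).1 b).
by apply: cvg_big => [|i _]; [exact: add_continuous | exact: (C1h i).2].
Qed.

Lemma C1_dot (R : realType) (V : normedModType R) (k : nat)
    (h l : V -> 'rV[R]_k) :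
  C1 h -> C1 l -> C1 (fun a => dot (h a) (l a)).
Proof. by move=> C1h C1l; apply: C1_sum => i; apply: C1_mul; exact: C1_coord. Qed.

Lemma differentiable_fst (R : realType) (U V : normedModType R) (a : U * V) :
  differentiable (@fst U V) a.
Proof. by apply: linear_differentiable => x; exact: cvg_fst. Qed.

Lemma differentiable_snd (R : realType) (U V : normedModType R) (a : U * V) :
  differentiable (@snd U V) a.
Proof. by apply: linear_differentiable => x; exact: cvg_snd. Qed.

Lemma C1_fst (R : realType) (U V W : normedModType R) (h : U -> W) :
  C1 h -> C1 (fun a : U * V => h a.1).
Proof.
apply: (@C1_comp_affine R (U * V)%type U W fst fst); first by [].
exact: differentiable_fst.
Qed.

Lemma C1_snd (R : realType) (U V W : normedModType R) (h : V -> W) :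
  C1 h -> C1 (fun a : U * V => h a.2).
Proof.
apply: (@C1_comp_affine R (U * V)%type V W snd snd); first by [].
exact: differentiable_snd.
Qed.

Lemma C1_partial2 (R : realType) (U V W : normedModType R)
    (h : U * V -> W) (a : U) : C1 h -> C1 (fun t => h (a, t)).
Proof.
apply: (@C1_comp_affine R V (U * V)%type W (fun b => (a, b)) (fun b => (0, b))).
  by move=> b e t; congr pair; rewrite /= scaler0 add0r.
by move=> b; apply: differentiable_pair; exact: ex_diff.
Qed.

Lemma derive_partial1 (R : realType) (U V W : normedModType R)
    (h : U * V -> W) (a d : U) (s : V) :
  'D_d (fun b => h (b, s)) a = 'D_(d, 0) h (a, s).
Proof.
apply: (@derive_comp_affine R U (U * V)%type W (fun b => (b, s)) (fun b => (b, 0))).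
by move=> b e t; congr pair; rewrite /= scaler0 add0r.
Qed.

Lemma derive_partial2 (R : realType) (U V W : normedModType R)
    (h : U * V -> W) (a : U) (s d : V) :
  'D_d (fun t => h (a, t)) s = 'D_(0, d) h (a, s).
Proof.
apply: (@derive_comp_affine R V (U * V)%type W (fun b => (a, b)) (fun b => (0, b))).
by move=> b e t; congr pair; rewrite /= scaler0 add0r.
Qed.

Lemma derive_dotl (R : realType) (k : nat) (c a d : 'rV[R]_k) :
  'D_d (fun s => dot s c) a = dot d c.
Proof.
rewrite (@derive_comp_affine R _ _ _ (fun s => dot s c) (fun s => dot s c) id).
  exact: derive_id.
move=> s e t; rewrite /dot scaler_sumr -big_split; apply: eq_bigr => i _ /=.
by rewrite !mxE mulrDl -mulrA.
Qed.

Lemma derive_dotr (R : realType) (V : normedModType R) (k : nat)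
    (w : 'rV[R]_k) (h : V -> 'rV[R]_k) (a v : V) :
  C1 h ->
  'D_v (fun b => dot w (h b)) a = \sum_j w 0 j * 'D_v (fun b => h b 0 j) a.
Proof.
move=> C1h.
have dh j : derivable (fun b => h b 0 j) a v.
  exact: diff_derivable ((C1_coord j C1h).1 a).
have -> : (fun b => dot w (h b)) = \sum_j (w 0 j \*: (fun b => h b 0 j)).
  by apply/funext => b; rewrite fct_sumE.
rewrite derive_sum => [|j]; last exact: derivableZ.
by apply: eq_bigr => j _; rewrite deriveZ.
Qed.

Lemma dot_delta (R : realType) (k : nat) (i : 'I_k) (c : 'rV[R]_k) :
  dot (delta_mx 0 i) c = c 0 i.
Proof.
rewrite /dot (bigD1 i) //= mxE !eqxx mul1r big1 ?addr0 // => j /negPf ji.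
by rewrite mxE ji andbF mul0r.
Qed.

(** * First-order behaviour along converging sequences *)

Lemma mean_value_line (R : realType) (V : normedModType R) (h : V -> R)
    (p v : V) (t : R) :
  (forall a, differentiable h a) -> 0 < t ->
  exists2 c, 0 < c < t & h (p + t *: v) - h p = t * 'D_v h (p + c *: v).
Proof.
move=> dh t0.
pose l (r : R) := p + r *: v.
have lE r (s : R) e : l (e *: s + r) = e *: (s *: v) + l r.
  by rewrite /l scalerDl scalerA addrCA.
have dl r : differentiable l r by exact: differentiableD.
have dhl r : differentiable (h \o l) r by exact: differentiable_comp.
have [r _||c] := @MVT R (h \o l) (fun r => 'D_v h (l r)) 0 t t0.
- apply: DeriveDef; first exact: diff_derivable.
  by rewrite (@derive_comp_affine _ _ _ _ l (fun s => s *: v)) // scale1r.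
- by apply: continuous_subspaceT => r; exact: differentiable_continuous.
rewrite in_itv /= => c0t; rewrite /l scale0r addr0 subr0 mulrC => hE.
by exists c.
Qed.

Lemma cvg_perturb (R : realType) (V : normedModType R) (v p : V)
    (pk : nat -> V) (tk : nat -> R) :
  tk @ \oo --> 0 -> pk @ \oo --> p -> pk k + tk k *: v @[k --> \oo] --> p.
Proof.
move=> tkc pkc; rewrite -[X in _ --> X]addr0 -(scale0r v).
exact: cvgD pkc (cvgZr_tmp tkc).
Qed.

Lemma C1_cvg (R : realType) (V W : normedModType R) (h : V -> W) (p : V)
    (pk : nat -> V) :
  C1 h -> pk @ \oo --> p -> h (pk k) @[k --> \oo] --> h p.
Proof.
move=> C1h pkc; apply: (cvg_comp pk h pkc).
exact: differentiable_continuous (C1h.1 p).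
Qed.

(** Strict differentiability of [C1] functions: the base point of the difference
    quotient may move. This matters because optimal lower-level points [sk]
    only converge to [y], at no prescribed rate compared with [tk]. *)
Lemma strict_quotient_cvg (R : realType) (V : normedModType R) (h : V -> R)
    (v p : V) (pk : nat -> V) (tk : nat -> R) :
  C1 h -> (forall k, 0 < tk k) -> tk @ \oo --> 0 -> pk @ \oo --> p ->
  (fun k => (tk k)^-1 * (h (pk k + tk k *: v) - h (pk k))) @ \oo --> 'D_v h p.
Proof.
move=> [dh ch] tk0 tkc pkc.
have /choice[ck ckP] k : exists c, 0 < c < tk k /\
    h (pk k + tk k *: v) - h (pk k) = tk k * 'D_v h (pk k + c *: v).
  by have [c ? ?] := mean_value_line (pk k) v dh (tk0 k); exists c.
have ckc : ck @ \oo --> 0.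
  apply: (squeeze_cvgr _ (cvg_cst 0) tkc); near=> k.
  by have [/andP[/ltW -> /ltW ->]] := ckP k.
have -> : (fun k => (tk k)^-1 * (h (pk k + tk k *: v) - h (pk k))) =
    (fun k => 'D_v h (pk k + ck k *: v)).
  by apply/funext => k; rewrite (ckP k).2 mulKf // gt_eqF.
apply: (cvg_comp (fun k => pk k + ck k *: v) ('D_v h)); last exact: ch.
exact: cvg_perturb.
Unshelve. all: by end_near. Qed.

(** A constraint that is satisfied along [pk] survives a displacement [tk k *: v]
    whenever [v] decreases it to first order, if it is active at the limit. *)
Lemma eventually_nonpos (R : realType) (V : normedModType R) (h : V -> R)
    (v p : V) (pk : nat -> V) (tk : nat -> R) :
  C1 h -> (forall k, 0 < tk k) -> tk @ \oo --> 0 -> pk @ \oo --> p ->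
  (forall k, h (pk k) <= 0) -> (h p = 0 -> 'D_v h p < 0) ->
  \forall k \near \oo, h (pk k + tk k *: v) <= 0.
Proof.
move=> C1h tk0 tkc pkc hk hp.
have ch : {for p, continuous h} by exact: differentiable_continuous (C1h.1 p).
have : h p <= 0.
  have hc : h (pk k) @[k --> \oo] --> h p by exact: (cvg_comp pk h pkc ch).
  by rewrite -(cvg_lim _ hc) //; apply: limr_le; [exact: cvgP hc | near=> k].
rewrite le_eqVlt => /predU1P[/hp Dneg | hneg].
  have /cvgr_lt/(_ _ Dneg) := strict_quotient_cvg (v := v) C1h tk0 tkc pkc.
  move=> qneg; near=> k.
  have : (tk k)^-1 * (h (pk k + tk k *: v) - h (pk k)) < 0 by near: k.
  rewrite pmulr_rlt0 ?invr_gt0 // subr_lt0 => /ltW hlt.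
  exact: le_trans (hk k).
have hc : h (pk k + tk k *: v) @[k --> \oo] --> h p.
  apply: (cvg_comp (fun k => pk k + tk k *: v) h); last exact: ch.
  exact: cvg_perturb.
by move/cvgr_lt : hc => /(_ _ hneg); apply: filterS => k /ltW.
Unshelve. all: by end_near. Qed.

(** * The value function along a direction *)

Lemma C1_fdiag (R : realType) (n m : nat)
    (f0 : 'rV[R]_(n + m) -> 'rV[R]_m) : C1 f0 -> C1 (fdiag f0).
Proof.
apply: C1_dot.
apply: (@C1_comp_affine R _ _ _ (fun a : 'rV[R]_(n + m) => rsubmx a)
  (fun a => rsubmx a) id).
- by move=> a v t; rewrite linearP.
- exact: differentiable_rsubmx.
- exact: C1_id.
Qed.

Lemma gdiag_affine (R : realType) (n m : nat) (a v : 'rV[R]_(n + m)) (t : R) :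
  (t *: v + a, rsubmx (t *: v + a)) = t *: (v, rsubmx v) + (a, rsubmx a).
Proof. by rewrite linearP. Qed.

Lemma C1_gdiag (R : realType) (n m q : nat)
    (g0 : 'rV[R]_(n + m) -> 'rV[R]_m -> 'rV[R]_q) :
  C1 (fun a : 'rV[R]_(n + m) * 'rV[R]_m => g0 a.1 a.2) -> C1 (gdiag g0).
Proof.
apply: (C1_comp_affine (@gdiag_affine R n m)) => a.
apply: differentiable_pair; [exact: ex_diff | exact: differentiable_rsubmx].
Qed.

Lemma phi_S0 (R : realType) (N m q : nat) (f0 : 'rV[R]_N -> 'rV[R]_m)
    (g0 : 'rV[R]_N -> 'rV[R]_m -> 'rV[R]_q) (z : 'rV[R]_N) (s : 'rV[R]_m) :
  S0 f0 g0 z s -> phi f0 g0 z = (dot s (f0 z))%:E.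
Proof.
move=> [Ks sP]; apply/eqP; rewrite eq_le; apply/andP; split.
  by apply: ereal_inf_lbound; exists s.
by apply: le_ereal_inf_tmp => _ [t Kt <-]; rewrite lee_fin sP.
Qed.

Definition lower_obj (R : realType) (N m : nat) (f0 : 'rV[R]_N -> 'rV[R]_m)
    (a : 'rV[R]_N * 'rV[R]_m) : R := dot a.2 (f0 a.1).

Lemma C1_lower_obj (R : realType) (N m : nat) (f0 : 'rV[R]_N -> 'rV[R]_m) :
  C1 f0 -> C1 (lower_obj f0).
Proof.
move=> C1f; apply: C1_dot; last exact: C1_fst.
exact: (C1_snd _ (@C1_id _ _)).
Qed.

(** The one-sided directional estimate on the value function, combined with
    partial calmness. For [z_k = z + t_k d] and solutions [s_k] of the lower-level
    problem at [z_k], the point [s_k + t_k eta] is feasible at [z], so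
    [phi z_k - phi z >= H (z_k, s_k) - H (z, s_k + t_k eta)] with [H] the
    lower-level objective; after division by [t_k] the right-hand side tends to
    minus the derivative of [H] along [(- d, eta)]. *)
Lemma calm_value_inequality (R : realType) (n m p q : nat)
    (F : 'rV[R]_(n + m) -> R) (G : 'rV[R]_(n + m) -> 'rV[R]_p)
    (f0 : 'rV[R]_(n + m) -> 'rV[R]_m)
    (g0 : 'rV[R]_(n + m) -> 'rV[R]_m -> 'rV[R]_q) (z : 'rV[R]_(n + m)) :
  C1 F -> C1 G -> C1 f0 ->
  C1 (fun a : 'rV[R]_(n + m) * 'rV[R]_m => g0 a.1 a.2) ->
  nonpos (G z) -> inner_semicontinuous (S0 f0 g0) z (rsubmx z) ->
  partially_calm F G f0 g0 z ->
  exists2 lam : R, 0 < lam & forall d eta,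
    (forall i, G z 0 i = 0 -> 'D_d (fun a => G a 0 i) z < 0) ->
    (forall j, gdiag g0 z 0 j = 0 -> 'D_d (fun a => gdiag g0 a 0 j) z < 0) ->
    (forall j, g0 z (rsubmx z) 0 j = 0 ->
       'D_(- d, eta) (fun a => g0 a.1 a.2 0 j) (z, rsubmx z) < 0) ->
    0 <= 'D_d F z + lam * ('D_d (fdiag f0) z +
           'D_(- d, eta) (lower_obj f0) (z, rsubmx z)).
Proof.
move=> C1F C1G C1f C1g Gz [Sz isc] [lam lam0 [U Uz calm]].
exists lam => // d eta Gd gd g0d; set y := rsubmx z in Sz isc g0d *.
have t0 k : 0 < harmonic k :> R by exact: harmonic_gt0.
have tc : @harmonic R @ \oo --> 0 by exact: cvg_harmonic.
pose zk k := z + harmonic k *: d.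
have zkc : zk @ \oo --> z by exact: cvg_perturb tc (cvg_cst _).
have [sk [Sk skc]] := isc zk zkc.
have pkc : (zk k, sk k) @[k --> \oo] --> (z, y).
  exact: (@cvg_pair _ _ _ _ (nbhs z) (nbhs y) _ _ _ zk sk zkc skc).
have HC1 := C1_lower_obj C1f; set H := lower_obj f0 in HC1 *.
have fC1 := C1_fdiag C1f.
have gC1 := C1_gdiag C1g.
have zcst : (fun _ : nat => z) @ \oo --> z by exact: cvg_cst.
have GU : \forall k \near \oo, forall i, G (zk k) 0 i <= 0.
  apply: filter_forall => i.
  have := eventually_nonpos (v := d) (C1_coord i C1G) t0 tc zcst.
  by apply=> [_|]; [exact: Gz | exact: Gd].
have gU : \forall k \near \oo, forall j, gdiag g0 (zk k) 0 j <= 0.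
  apply: filter_forall => j.
  have := eventually_nonpos (v := d) (C1_coord j gC1) t0 tc zcst.
  by apply=> [_|]; [exact: Sz.1 | exact: gd].
(* The feasibility that transfers the solution at [zk k] back to [z]: going from
   [(zk k, sk k)] along [(- d, eta)] lands in the fibre over [z] exactly. *)
have g0U : \forall k \near \oo, forall j, g0 z (sk k + harmonic k *: eta) 0 j <= 0.
  apply: filter_forall => j.
  have : \forall k \near \oo, g0 (zk k - harmonic k *: d)
                                 (sk k + harmonic k *: eta) 0 j <= 0.
    have := eventually_nonpos (v := (- d, eta))
      (C1_coord j C1g) t0 tc pkc.
    move=> /(_ (fun k => (Sk k).1 j) (g0d j)); apply: filterS => k /=.
    by rewrite scalerN.
  by apply: filterS => k; rewrite addrK.
(* The perturbation parameter in partial calmness is the negative value gap, which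
   tends to zero because [sk] tends to [y]. *)
have calmU : \forall k \near \oo, U (H (zk k, sk k) - fdiag f0 (zk k), zk k).
  have cU : (H (zk k, sk k) - fdiag f0 (zk k), zk k) @[k --> \oo] --> (0 : R, z).
    apply: (@cvg_pair _ _ _ _ (nbhs (0 : R)) (nbhs z)) => //.
    rewrite -(subrr (fdiag f0 z)) -[X in X - _]/(H (z, y)).
    apply: cvgB; [exact: C1_cvg HC1 pkc | exact: C1_cvg fC1 zkc].
  exact: cU.
have Fq := strict_quotient_cvg (v := d) C1F t0 tc zcst.
have fq := strict_quotient_cvg (v := d) fC1 t0 tc zcst.
have Hq := strict_quotient_cvg (v := (- d, eta)) HC1 t0 tc pkc.
have Tq : (harmonic k)^-1 * (F (zk k) - F z) + lam *
      ((harmonic k)^-1 * (fdiag f0 (zk k) - fdiag f0 z) +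
       (harmonic k)^-1 * (H ((zk k, sk k) + harmonic k *: (- d, eta)) -
                          H (zk k, sk k))) @[k --> \oo] -->
    'D_d F z + lam * ('D_d (fdiag f0) z + 'D_(- d, eta) H (z, y)).
  exact: (cvgD Fq (cvgM (cvg_cst lam) (cvgD fq Hq))).
rewrite -(cvg_lim _ Tq) //; apply: limr_ge; first exact: cvgP Tq.
near=> k; rewrite /=.
have GUk : nonpos (G (zk k)) by near: k.
have gUk : nonpos (gdiag g0 (zk k)) by near: k.
have g0Uk : nonpos (g0 z (sk k + harmonic k *: eta)) by near: k.
have Uk : U (H (zk k, sk k) - fdiag f0 (zk k), zk k) by near: k.
have phik : phi f0 g0 (zk k) = (H (zk k, sk k))%:E by exact: phi_S0.
have := calm _ _ Uk GUk gUk; rewrite phik -EFinB -EFinD.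
have -> : fdiag f0 (zk k) - H (zk k, sk k) + (H (zk k, sk k) - fdiag f0 (zk k)) = 0.
  by ring.
have Hle : H (zk k, sk k) <= fdiag f0 (zk k) by exact: (Sk k).2.
(* Optimality of [y] at [z] against the transported point. *)
have zle : fdiag f0 z <= H (z, sk k + harmonic k *: eta) by exact: Sz.2.
move=> /(_ erefl); rewrite ler0_norm ?subr_le0 // => calmk.
have -> : harmonic k *: (- d, eta) = (- (harmonic k *: d), harmonic k *: eta).
  by rewrite -scalerN.
have -> : (zk k, sk k) + (- (harmonic k *: d), harmonic k *: eta) =
    (z, sk k + harmonic k *: eta) by congr pair; exact: addrK.
rewrite -mulrDr mulrCA -mulrDr mulr_ge0 ?invr_ge0 ?(ltW (t0 k)) //.
apply: (le_trans calmk); rewrite -/(zk k) lerD2l ler_pM2l //.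
by lra.
Unshelve. all: by end_near. Qed.

(** * Multipliers *)

Theorem theorem5p3 (R : realType) (n m p q : nat)
    (F : 'rV[R]_(n + m) -> R)
    (G : 'rV[R]_(n + m) -> 'rV[R]_p)
    (f0 : 'rV[R]_(n + m) -> 'rV[R]_m)
    (g0 : 'rV[R]_(n + m) -> 'rV[R]_m -> 'rV[R]_q)
    (hF : C2 F) (hG : C2 G) (hf0 : C2 f0)
    (hg0 : C2 (fun a : 'rV[R]_(n + m) * 'rV[R]_m => g0 a.1 a.2))
    (x : 'rV[R]_n) (y : 'rV[R]_m) :
  let z := row_mx x y in
  local_solution F G f0 g0 z ->
  inner_semicontinuous (S0 f0 g0) z y ->
  lower_regular g0 z y ->
  partially_calm F G f0 g0 z ->
  upper_regular G g0 z ->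
  exists (lam : R) (u : 'rV[R]_p) (v w : 'rV[R]_q),
    0 < lam /\
    grad F z + u *m ('J G z)^T + v *m ('J (gdiag g0) z)^T
      + lam *: grad (fdiag f0) z
      - lam *: grad (fun a => lagr f0 g0 a y w) z = 0 /\
    f0 z + w *m ('J (g0 z) y)^T = 0 /\
    [/\ nonneg u, nonpos (G z) & dot u (G z) = 0] /\
    [/\ nonneg v, nonpos (gdiag g0 z) & dot v (gdiag g0 z) = 0] /\
    [/\ nonneg w, nonpos (g0 z y) & dot w (g0 z y) = 0].
Proof.
move=> z [[Gz gz _] _] isc [s0 s0P] calm [d0 [d0G d0g]].
have C1F := hF.1; have C1G := hG.1; have C1f := hf0.1; have C1g := hg0.1.
have zy : rsubmx z = y by rewrite row_mxKr.
have gzy : gdiag g0 z = g0 z y by rewrite /gdiag zy.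
have fC1 := C1_fdiag C1f.
have gC1 := C1_gdiag C1g.
have HC1 := C1_lower_obj C1f; set H := lower_obj f0 in HC1.
pose g j := fun a : 'rV[R]_(n + m) * 'rV[R]_m => g0 a.1 a.2 0 j.
have gjC1 j : C1 (g j) by exact: C1_coord C1g.
have GiC1 i : C1 (fun a => G a 0 i) by exact: C1_coord.
have gdC1 j : C1 (fun a => gdiag g0 a 0 j) by exact: C1_coord.
have [lam lam0 desc] : exists2 lam : R, 0 < lam & forall d eta,
    (forall i, G z 0 i = 0 -> 'D_d (fun a => G a 0 i) z < 0) ->
    (forall j, g0 z y 0 j = 0 -> 'D_d (fun a => gdiag g0 a 0 j) z < 0) ->
    (forall j, g0 z y 0 j = 0 -> 'D_(- d, eta) (g j) (z, y) < 0) ->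
    0 <= 'D_d F z + lam * ('D_d (fdiag f0) z + 'D_(- d, eta) H (z, y)).
  rewrite -gzy -zy; apply: calm_value_inequality calm => //.
  by rewrite zy.
pose b (k : 'I_p + 'I_q + 'I_q) (e : 'rV[R]_(n + m) * 'rV[R]_m) : R :=
  match k with
  | inl (inl i) => 'D_(e.1) (fun a => G a 0 i) z
  | inl (inr j) => 'D_(e.1) (fun a => gdiag g0 a 0 j) z
  | inr j => 'D_(- e.1, e.2) (g j) (z, y)
  end.
pose act (k : 'I_p + 'I_q + 'I_q) : bool :=
  match k with
  | inl (inl i) => G z 0 i == 0
  | inl (inr j) => g0 z y 0 j == 0
  | inr j => g0 z y 0 j == 0
  end.
pose c (e : 'rV[R]_(n + m) * 'rV[R]_m) : R :=
  'D_(e.1) F z + lam * ('D_(e.1) (fdiag f0) z + 'D_(- e.1, e.2) H (z, y)).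
have linb k : scalar (b k).
  case: k => [[i|j]|j] /=.
  - by move=> t e e'; exact: scalar_derive ((GiC1 i).1 z) t e.1 e'.1.
  - by move=> t e e'; exact: scalar_derive ((gdC1 j).1 z) t e.1 e'.1.
  - exact: scalar_derive_reflect ((gjC1 j).1 _).
have linc : scalar c.
  move=> t e e'; rewrite /c.
  rewrite (scalar_derive_reflect (HC1.1 _) t e e').
  rewrite (scalar_derive (C1F.1 z) t e.1 e'.1).
  rewrite (scalar_derive (fC1.1 z) t e.1 e'.1).
  move: ('D_(- e.1, e.2) H (z, y)) ('D_(- e'.1, e'.2) H (z, y)) => dH dH'.
  move: ('D_(e.1) F z) ('D_(e'.1) F z) => dF dF'.
  move: ('D_(e.1) (fdiag f0) z) ('D_(e'.1) (fdiag f0) z) => df df'.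
  by ring.
(* Only the third family couples the two directions: keeping the lower-level
   direction and scaling the upper-level one down makes the lower-level term
   dominate there. *)
have slater : exists e, forall k, act k -> b k e < 0.
  pose J := [seq j <- enum 'I_q | g0 z y 0 j == 0].
  have [|eps eps0 epsP] := @small_perturbation_neg R _ J
    (fun j => 'D_(0, s0) (g j) (z, y)) (fun j => 'D_(- d0, 0) (g j) (z, y)).
    move=> j; rewrite mem_filter => /andP[/eqP gj0 _].
    have := s0P j gj0; rewrite dot_grad.
      by rewrite (derive_partial2 (g j)).
    exact: (C1_partial2 z (gjC1 j)).1.
  exists (eps *: d0, s0) => -[[i|j]|j] /= /eqP a0.
  - rewrite derive_scale; last exact: (GiC1 i).1.
    rewrite -dot_grad; last exact: (GiC1 i).1.
    by rewrite pmulr_rlt0 // d0G.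
  - rewrite derive_scale; last exact: (gdC1 j).1.
    rewrite -dot_grad; last exact: (gdC1 j).1.
    by rewrite pmulr_rlt0 // d0g // gzy.
  - have := epsP j; rewrite mem_filter a0 eqxx mem_enum => /(_ isT).
    rewrite addrC -(scalar_derive ((gjC1 j).1 _) eps).
    suff -> : (- (eps *: d0), s0) = eps *: (- d0, 0) + (0, s0) by [].
    by congr pair; rewrite /= ?scalerN ?addr0 ?scaler0 ?add0r.
have [|mu [mu0 musupp muE]] := motzkin_multipliers linb linc slater.
  move=> e eP; apply: desc => [i Gi|j gj|j gj].
  - by apply: (eP (inl (inl i))); apply/eqP.
  - by apply: (eP (inl (inr j))); apply/eqP.
  - by apply: (eP (inr j)); apply/eqP.
pose u : 'rV[R]_p := \row_i mu (inl (inl i)).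
pose v : 'rV[R]_q := \row_j mu (inl (inr j)).
(* The functional [c] carries the factor [lam] on the lower-level objective, so
   the lower-level multipliers come out scaled by [lam]. *)
pose w : 'rV[R]_q := \row_j (mu (inr j) / lam).
have lamN : lam != 0 by rewrite gt_eqF.
pose L a := H a + dot w (g0 a.1 a.2).
have dwg : differentiable (fun a => dot w (g0 a.1 a.2)) (z, y).
  exact: (C1_dot (C1_cst _ w) C1g).1.
have dLz : differentiable L (z, y) by exact: differentiableD (HC1.1 _) dwg.
have dL e : 'D_e L (z, y) = 'D_e H (z, y) + \sum_j w 0 j * 'D_e (g j) (z, y).
  rewrite deriveD; [|exact: diff_derivable (HC1.1 _)|exact: diff_derivable].
  by rewrite (derive_dotr w _ _ C1g).
have statE d eta :
    'D_d F z + \sum_i u 0 i * 'D_d (fun a => G a 0 i) z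
    + \sum_j v 0 j * 'D_d (fun a => gdiag g0 a 0 j) z
    + lam * 'D_d (fdiag f0) z + lam * 'D_(- d, eta) L (z, y) = 0.
  rewrite -[RHS](muE (d, eta)) /c dL !big_sumType /=.
  rewrite [lam * (_ + \sum_j _)]mulrDr mulr_sumr.
  under [\sum_i u 0 i * _]eq_bigr do rewrite mxE.
  under [\sum_i v 0 i * _]eq_bigr do rewrite mxE.
  under [\sum_j lam * _]eq_bigr do rewrite mxE mulrA mulrCA divff // mulr1.
  by ring.
exists lam, u, v, w; split=> //; split.
  apply/rowP => i; have := statE (delta_mx 0 i) 0.
  have := mul_jacobian_tr v i (gC1.1 z).
  have := mul_jacobian_tr u i (C1G.1 z).
  have -> : 'D_(- delta_mx 0 i, 0) L (z, y) =
      - 'D_(delta_mx 0 i) (fun a => lagr f0 g0 a y w) z.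
    rewrite (derive_partial1 L) !deriveE // -linearN /=.
    by congr ('d L _ (_, _)); rewrite oppr0.
  move: (u *m _) (v *m _) => uJ vJ uE vE; rewrite -uE -vE !mxE => <-.
  by ring.
(* With no upper-level displacement, only the lower-level stationarity is left. *)
split.
  apply/rowP => i; have := statE 0 (delta_mx 0 i).
  rewrite oppr0 !derive0 dL.
  have -> : 'D_(0, delta_mx 0 i) H (z, y) = f0 z 0 i.
    by rewrite -(derive_partial2 H) -(dot_delta i) -(derive_dotl _ y).
  rewrite big1 => [|k _]; last by rewrite derive0 mulr0.
  rewrite big1 => [|k _]; last by rewrite derive0 mulr0.
  rewrite mulr0 !add0r => /eqP; rewrite mulf_eq0 (negPf lamN) /= => /eqP E.
  have C1gz : C1 (g0 z) by exact: C1_partial2 z C1g.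
  rewrite [LHS]mxE mul_jacobian_tr; last exact: C1gz.1.
  rewrite [RHS]mxE -[RHS]E; congr (_ + _); apply: eq_bigr => j _.
  by rewrite -(derive_partial2 (g j)).
have compl k r : mu k * r = 0 \/ act k.
  by have [|/musupp ->] := boolP (act k); [right | left; rewrite mul0r].
split.
  split=> // [i|]; first by rewrite mxE.
  apply: big1 => i _; rewrite mxE.
  by have [//|/= /eqP ->] := compl (inl (inl i)) (G z 0 i); rewrite mulr0.
split.
  split=> // [j|]; first by rewrite mxE.
  apply: big1 => j _; rewrite mxE gzy.
  by have [//|/= /eqP ->] := compl (inl (inr j)) (g0 z y 0 j); rewrite mulr0.
split=> [j||]; [by rewrite mxE divr_ge0 // ltW | by rewrite -gzy |].
apply: big1 => j _; rewrite mxE mulrAC.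
by have [->|/= /eqP ->] := compl (inr j) (g0 z y 0 j); rewrite ?mulr0 mul0r.
Qed.
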